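(* Let $\mathcal{G}$ be a hereditary family of finite undirected graphs (closed under taking induced subgraphs). If the algorithm TSS is optimal for $\mathcal{G}$, then the algorithm MTS is optimal for $\mathcal{G}$. Here an algorithm is optimal for $\mathcal{G}$ if, for every $G=(V,E)\in\mathcal{G}$ and every threshold function $t:V\to\mathbb{N}$, it returns (in every execution) a minimum-size target set for $G$ with thresholds $t$.
   Context: Graphs are finite, without loops; $\Gamma(v)$ is the neighborhood in an undirected graph. An undirected graph is treated as the bidirected digraph in which each edge $\{u,v\}$ is replaced by the two arcs $(u,v),(v,u)$, so $\Gamma^{in}(v)=\Gamma^{out}(v)=\Gamma(v)$. Given thresholds $t:V\to\mathbb{N}=\{0,1,2,\dots\}$ and $S\subseteq V$, the activation process starting at $S$ is $A_0=S$ and $A_\ell=A_{\ell-1}\cup\{u\in V: |\Gamma(u)\cap A_{\ell-1}|\ge t(u)\}$ for $\ell\ge1$. $S$ is a target set for $(G,t)$ if $A_\lambda=V$ for some $\lambda\ge0$. Algorithm MTS on input $(G,t)$: set $S=\emptyset$, $L=\emptyset$, $U=V$, and for each $v\in V$ set $k(v)=t(v)$, $\delta(v)=|\Gamma^{in}(v)|$. While $U\neq\emptyset$, perform one iteration as follows. Case 1: if some $v\in U$ has $k(v)=0$, select such a $v$; for each $u\in\Gamma^{out}(v)\cap U$ set $k(u)=\max(k(u)-1,0)$ and, if $v\notin L$, set $\delta(u)=\delta(u)-1$; then set $U=U\setminus\{v\}$. Case 2: otherwise, if some $v\in U\setminus L$ has $\delta(v)<k(v)$, select such a $v$; set $S=S\cup\{v\}$;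 for each $u\in\Gamma^{out}(v)\cap U$ set $k(u)=k(u)-1$ and $\delta(u)=\delta(u)-1$; then set $U=U\setminus\{v\}$. Case 3: otherwise, select $v\in U\setminus L$ maximizing $\frac{k(u)}{\delta(u)(\delta(u)+1)}$ over $u\in U\setminus L$; for each $u\in\Gamma^{out}(v)\cap U$ set $\delta(u)=\delta(u)-1$; set $L=L\cup\{v\}$. When $U=\emptyset$, return $S$. Algorithm TSS on input $(G,t)$ ($G$ undirected): set $S=\emptyset$, $U=V$, and for each $v$ set $k(v)=t(v)$, $\delta(v)=|\Gamma(v)|$. While $U\neq\emptyset$: Case 1: if some $v\in U$ has $k(v)=0$, select such $v$ and for each $u\in\Gamma(v)\cap U$ set $k(u)=\max(k(u)-1,0)$; Case 2: otherwise, if some $v\in U$ has $\delta(v)<k(v)$, select such $v$, set $S=S\cup\{v\}$, and for each $u\in\Gamma(v)\cap U$ set $k(u)=k(u)-1$; Case 3: otherwise select $v\in U$ maximizing $\frac{k(u)}{\delta(u)(\delta(u)+1)}$ over $u\in U$. In all three cases, then for each $u\in\Gamma(v)\cap U$ set $\delta(u)=\delta(u)-1$, and set $U=U\setminus\{v\}$. When $U=\emptyset$, return $S$. In both algorithms, whenever several nodes qualify in a case, one of them is chosen arbitrarily. *)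

(* Defs.v *)
From HB Require Import structures.
From mathcomp Require Import all_boot all_order all_algebra.

Set Implicit Arguments.
Unset Strict Implicit.
Unset Printing Implicit Defensive.

Record sgraph : Type := SGraph {
  vertex :> finType;
  adj : rel vertex;
  adj_sym : symmetric adj;
  adj_irrefl : irreflexive adj
}.

Section Induced.
Variables (G : sgraph) (A : {set G}).
Let iadj : rel {x : G | x \in A} := relpre val (@adj G).

Lemma iadj_sym : symmetric iadj.
Proof. by move=> x y; rewrite /iadj /= adj_sym. Qed.

Lemma iadj_irrefl : irreflexive iadj.
Proof. by move=> x; rewrite /iadj /= adj_irrefl. Qed.

Definition induced : sgraph := SGraph iadj_sym iadj_irrefl.
End Induced.

Definition hereditary (F : sgraph -> Prop) : Prop :=
  forall (G : sgraph) (A : {set G}), F G -> F (induced A).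

Definition nbh (G : sgraph) (v : G) : {set G} := [set u | adj v u].

Fixpoint active (G : sgraph) (t : G -> nat) (S : {set G}) (l : nat) : {set G} :=
  if l is l'.+1 then
    active t S l' :|: [set u | t u <= #|nbh u :&: active t S l'|]
  else S.

Definition target_set (G : sgraph) (t : G -> nat) (S : {set G}) : Prop :=
  exists l : nat, active t S l = [set: G].

Definition min_target_set (G : sgraph) (t : G -> nat) (S : {set G}) : Prop :=
  target_set t S /\ forall S' : {set G}, target_set t S' -> #|S| <= #|S'|.

(* Total correctness of a nondeterministic loop: whatever choices are made,    *)
(* the loop started at s never gets stuck before halting, halts after finitely *)
(* many iterations, and does so in a state satisfying Q.                       *)
Inductive always_returns (state : Type) (step : state -> state -> Prop)
    (halted : state -> Prop) (Q : state -> Prop) (s : state) : Prop :=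
  | Return of halted s & Q s
  | Iterate of ~ halted s & (exists s', step s s')
      & (forall s', step s s' -> always_returns step halted Q s').

(* dec A f lowers f by 1 on A; subtraction on nat being truncated, this is     *)
(* max(f u - 1, 0). *)
Definition dec (V : finType) (A : {set V}) (f : {ffun V -> nat}) :
    {ffun V -> nat} :=
  [ffun u => if u \in A then f u - 1 else f u].

Definition score (V : finType) (k d : {ffun V -> nat}) (u : V) : rat :=
  ((k u)%:R / (d u * (d u + 1))%N%:R)%R.

Record tss_state (V : finType) : Type := TssState {
  tss_S : {set V};
  tss_U : {set V};
  tss_k : {ffun V -> nat};
  tss_d : {ffun V -> nat}
}.

Definition tss_init (G : sgraph) (t : G -> nat) : tss_state G :=
  TssState set0 [set: G] [ffun v => t v] [ffun v => #|nbh v|].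

Inductive tss_step (G : sgraph) : tss_state G -> tss_state G -> Prop :=
  | TssCase1 (S U : {set G}) (k d : {ffun G -> nat}) (v : G) of
      v \in U & k v = 0 :
      tss_step (TssState S U k d)
        (TssState S (U :\ v) (dec (nbh v :&: U) k) (dec (nbh v :&: U) d))
  | TssCase2 (S U : {set G}) (k d : {ffun G -> nat}) (v : G) of
      ~ (exists2 w, w \in U & k w = 0)
      & v \in U & d v < k v :
      tss_step (TssState S U k d)
        (TssState (v |: S) (U :\ v)
           (dec (nbh v :&: U) k) (dec (nbh v :&: U) d))
  | TssCase3 (S U : {set G}) (k d : {ffun G -> nat}) (v : G) of
      ~ (exists2 w, w \in U & k w = 0)
      & ~ (exists2 w, w \in U & d w < k w)
      & v \in U & (forall u, u \in U -> (score k d u <= score k d v)%R) :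
      tss_step (TssState S U k d)
        (TssState S (U :\ v) k (dec (nbh v :&: U) d)).

Definition TSS (G : sgraph) (t : G -> nat) (Q : {set G} -> Prop) : Prop :=
  always_returns (@tss_step G) (fun s => tss_U s = set0)
    (fun s => Q (tss_S s)) (tss_init t).

Section MTS.
Variables (V : finType) (arc : rel V).

Definition nbh_in (v : V) : {set V} := [set u | arc u v].
Definition nbh_out (v : V) : {set V} := [set u | arc v u].

Record mts_state : Type := MtsState {
  mts_S : {set V};
  mts_L : {set V};
  mts_U : {set V};
  mts_k : {ffun V -> nat};
  mts_d : {ffun V -> nat}
}.

Definition mts_init (t : V -> nat) : mts_state :=
  MtsState set0 set0 [set: V] [ffun v => t v] [ffun v => #|nbh_in v|].

Inductive mts_step : mts_state -> mts_state -> Prop :=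
  | MtsCase1 (S L U : {set V}) (k d : {ffun V -> nat}) (v : V) of
      v \in U & k v = 0 :
      mts_step (MtsState S L U k d)
        (MtsState S L (U :\ v) (dec (nbh_out v :&: U) k)
           (if v \in L then d else dec (nbh_out v :&: U) d))
  | MtsCase2 (S L U : {set V}) (k d : {ffun V -> nat}) (v : V) of
      ~ (exists2 w, w \in U & k w = 0)
      & v \in U :\: L & d v < k v :
      mts_step (MtsState S L U k d)
        (MtsState (v |: S) L (U :\ v)
           (dec (nbh_out v :&: U) k) (dec (nbh_out v :&: U) d))
  | MtsCase3 (S L U : {set V}) (k d : {ffun V -> nat}) (v : V) of
      ~ (exists2 w, w \in U & k w = 0)
      & ~ (exists2 w, w \in U :\: L & d w < k w)
      & v \in U :\: L
      & (forall u, u \in U :\: L -> (score k d u <= score k d v)%R) :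
      mts_step (MtsState S L U k d)
        (MtsState S (v |: L) U k (dec (nbh_out v :&: U) d)).

End MTS.

(* The symmetric relation adj is itself the bidirected digraph of G. *)
Definition MTS (G : sgraph) (t : G -> nat) (Q : {set G} -> Prop) : Prop :=
  always_returns (mts_step (@adj G)) (fun s => mts_U s = set0)
    (fun s => Q (mts_S s)) (mts_init (@adj G) t).

(* alg G t Q reads: every execution of alg on (G, t) returns a set in Q. *)
Definition optimal
    (alg : forall G : sgraph, (G -> nat) -> ({set G} -> Prop) -> Prop)
    (F : sgraph -> Prop) : Prop :=
  forall G : sgraph, F G -> forall t : G -> nat, alg G t (min_target_set t).

(* Main.v *)
Require Import Defs.
From mathcomp Require Import all_boot all_order all_algebra.

(** At any moment of an execution of MTS let [W = U :\: L].  A step of MTS that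
    selects a node of [W] is a legal first step of TSS on the graph induced by
    [W] with the current thresholds [k], and what remains of that TSS execution
    is an execution on [W] minus the node.  As TSS is optimal on both induced
    graphs, [#|S|] plus the optimum of the instance [(W, k)] is unchanged.  A
    step of MTS that selects a node of [L] only lowers thresholds on [W], so this
    quantity cannot increase.  It starts as the optimum of [(G, t)] and ends as
    [#|S|]. *)

Set Implicit Arguments.
Unset Strict Implicit.
Unset Printing Implicit Defensive.

Import Order.TTheory.

(** * Reasoning about nondeterministic loops *)

Section AlwaysReturns.
Variables (state : Type) (step : state -> state -> Prop).
Variable (halted : state -> Prop).

(** A state that has not halted has some step, so following one execution reaches a final state
    where both properties hold. This extracts an actual output, and it shows that two claimed output
    sizes agree. *)
Lemma always_returns_both (P Q : state -> Prop) s :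
  always_returns step halted P s -> always_returns step halted Q s ->
  exists2 s', P s' & Q s'.
Proof.
elim=> {s} [s hs Ps|s nhs [s' st] _ IH] rQ.
  by case: rQ => [_ Qs|/(_ hs)//]; exists s.
by case: rQ => [/nhs//|_ _ /(_ _ st)]; apply: IH.
Qed.

Lemma always_returns_weaken (P Q : state -> Prop) s :
  (forall s', P s' -> Q s') ->
  always_returns step halted P s -> always_returns step halted Q s.
Proof.
move=> PQ; elim=> {s} [s hs Ps|s nhs ex _ IH]; last exact: Iterate.
by apply: Return => //; apply: PQ.
Qed.

Lemma always_returns_invariant (I : state -> Prop) (m : state -> nat)
    (Q : state -> Prop) :
  (forall s, halted s \/ ~ halted s) ->
  (forall s, I s -> ~ halted s -> exists s', step s s') ->
  (forall s s', I s -> step s s' -> I s' /\ m s' < m s) ->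
  (forall s, I s -> halted s -> Q s) ->
  forall s, I s -> always_returns step halted Q s.
Proof.
move=> dec_halted progress preserve final s.
have [n] := ubnP (m s); elim: n s => // n IH s le_n Is.
have [hs|nhs] := dec_halted s; first by apply: Return => //; apply: final.
apply: Iterate => // [|s' st]; first exact: progress.
have [Is' lt_m] := preserve _ _ Is st.
by apply: IH => //; apply: leq_trans lt_m _.
Qed.

End AlwaysReturns.

(** [U] and [W] are kept apart to serve TSS with [W = U] and MTS with [W = U :\: L]. In MTS [W] may
    be empty, so the maximizer is promised only given some [v0]. *)
Lemma case_selection (V : finType) (k d : {ffun V -> nat}) (U W : {set V}) :
  [\/ exists2 v, v \in U & k v = 0,
      ~ (exists2 v, v \in U & k v = 0) /\ exists2 v, v \in W & d v < k v |
      [/\ ~ (exists2 v, v \in U & k v = 0),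
          ~ (exists2 v, v \in W & d v < k v) &
          forall v0, v0 \in W -> exists2 v, v \in W &
            forall u, u \in W -> (score k d u <= score k d v)%R]].
Proof.
have [/existsP[v /andP[vU /eqP kv]]|no1] :=
  boolP [exists v, (v \in U) && (k v == 0)].
  by apply: Or31; exists v.
have {}no1 : ~ (exists2 v, v \in U & k v = 0).
  by case=> v vU kv; case/existsP: no1; exists v; rewrite vU kv eqxx.
have [/existsP[v /andP[vW dv]]|no2] :=
  boolP [exists v, (v \in W) && (d v < k v)].
  by apply: Or32; split=> //; exists v.
have {}no2 : ~ (exists2 v, v \in W & d v < k v).
  by case=> v vW dv; case/existsP: no2; exists v; rewrite vW.
apply: Or33; split=> // v0 v0W.
by case: (arg_maxP (score k d) v0W) => v vW maxv; exists v.
Qed.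

Lemma tss_progress (G : sgraph) (s : tss_state G) :
  tss_U s <> set0 -> exists s', tss_step s s'.
Proof.
case: s => S U k d /= /eqP/set0Pn[v0 v0U].
case: (case_selection k d U U) => [[v vU kv]|[no1 [v vU dv]]|[no1 no2 maxP]].
- by eexists; apply: TssCase1 kv.
- by eexists; apply: TssCase2 dv.
- by have [v vU maxv] := maxP _ v0U; eexists; apply: TssCase3 maxv.
Qed.

(** * Transfer of TSS executions along induced embeddings *)

Section Embedding.
Variables (H G : sgraph) (f : H -> G).
Hypotheses (f_inj : injective f) (f_adj : {mono f : x y / adj x y}).

Lemma dec_embed (U : {set H}) (h : {ffun H -> nat}) (g : {ffun G -> nat}) v :
  {in U, forall x, g (f x) = h x} ->
  {in U :\ v, forall x,
     dec (nbh (f v) :&: f @: U) g (f x) = dec (nbh v :&: U) h x}.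
Proof.
move=> gh x /setD1P[_ xU].
by rewrite !ffunE !inE f_adj (mem_imset _ _ f_inj) xU gh.
Qed.

(* Values of [k] and [d] outside [U] never influence an execution, so they are
   left unconstrained; [c] counts the nodes selected on the [G] side only. *)
Record tss_embeds (c : nat) (s : tss_state H) (s' : tss_state G) : Prop :=
  TssEmbeds {
    embeds_U : tss_U s' = f @: tss_U s;
    embeds_k : {in tss_U s, forall x, tss_k s' (f x) = tss_k s x};
    embeds_d : {in tss_U s, forall x, tss_d s' (f x) = tss_d s x};
    embeds_card : #|tss_S s'| = #|tss_S s| + c;
    embeds_dis : [disjoint tss_S s & tss_U s];
    embeds_dis' : [disjoint tss_S s' & tss_U s'] }.

Lemma disjointD1r (T : finType) (A B : {set T}) v :
  [disjoint A & B] -> [disjoint A & B :\ v].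
Proof. by apply: disjointWr; apply: subD1set. Qed.

Lemma disjointU1D1 (T : finType) (A B : {set T}) v :
  [disjoint A & B] -> [disjoint v |: A & B :\ v].
Proof.
move=> dAB; rewrite disjoints_subset; apply/subsetP=> x.
rewrite !inE => /orP[/eqP->|xA]; first by rewrite eqxx.
by rewrite (disjointFr dAB xA) andbF.
Qed.

Lemma imsetD1_inj (U : {set H}) v : f @: (U :\ v) = f @: U :\ f v.
Proof.
apply/setP=> y; apply/imsetP/setD1P => [[x /setD1P[xv xU] ->]|[yv /imsetP[x xU yE]]].
  by rewrite (inj_eq f_inj) imset_f.
by exists x => //; rewrite !inE xU andbT -(inj_eq f_inj) -yE.
Qed.

(** The simulation runs from [G] back to [H]: [always_returns] speaks of all executions, so each
    choice in [G] must be matched by one in [H], where the outcome is known. *)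
Lemma tss_embeds_step c s s' s1' :
  tss_embeds c s s' -> tss_step s' s1' ->
  exists2 s1, tss_step s s1 & tss_embeds c s1 s1'.
Proof.
case: s => S U k d E st; case: s' s1' / st E
  => S' U' k' d' w => [wU kw|no1 wU dw|no1 no2 wU maxw];
  case=> /= UE kE dE cE dis dis'; subst U';
  case/imsetP: wU => v vU wE; subst w.
- exists (TssState S (U :\ v) (dec (nbh v :&: U) k) (dec (nbh v :&: U) d)).
    by apply: TssCase1; rewrite -?kE.
  split=> //=; first by rewrite imsetD1_inj.
  + exact: dec_embed.
  + exact: dec_embed.
  + exact: disjointD1r.
  + exact: disjointD1r.
- exists (TssState (v |: S) (U :\ v)
            (dec (nbh v :&: U) k) (dec (nbh v :&: U) d)).
    apply: TssCase2 => //; last by rewrite -kE -?dE.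
    by case=> x xU kx; case: no1; exists (f x); rewrite ?imset_f ?kE.
  split=> //=; first by rewrite imsetD1_inj.
  + exact: dec_embed.
  + exact: dec_embed.
  (* By disjointness [v] and [f v] are new to their sets, so both sizes grow by one and the offset
     [c] persists. *)
  + rewrite !cardsU1 cE (disjointFl dis vU).
    by rewrite (disjointFl dis' (imset_f f vU)) addnA.
  + exact: disjointU1D1.
  + exact: disjointU1D1.
- exists (TssState S (U :\ v) k (dec (nbh v :&: U) d)).
    apply: TssCase3 => // [[x xU kx]|[x xU dx]|x xU].
    + by case: no1; exists (f x); rewrite ?imset_f ?kE.
    + by case: no2; exists (f x); rewrite ?imset_f ?kE ?dE.
    + by have := maxw _ (imset_f f xU); rewrite /score !kE ?dE.
  split=> //=; first by rewrite imsetD1_inj.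
  + by move=> x /setD1P[_ /kE].
  + exact: dec_embed.
  + exact: disjointD1r.
  + exact: disjointD1r.
Qed.

End Embedding.

Definition tss_returns_card (G : sgraph) (s : tss_state G) (n : nat) : Prop :=
  always_returns (@tss_step G) (fun s => tss_U s = set0)
    (fun s => #|tss_S s| = n) s.

Lemma tss_embeds_returns (H G : sgraph) (f : H -> G) c s s' n :
  injective f -> {mono f : x y / adj x y} -> tss_embeds f c s s' ->
  tss_returns_card s n -> tss_returns_card s' (n + c).
Proof.
move=> f_inj f_adj E r; elim: r s' E => {s} [s Us Sn|s Us _ _ IH] s' E.
  apply: Return; first by rewrite (embeds_U E) Us imset0.
  by rewrite (embeds_card E) Sn.
have Us' : tss_U s' <> set0.
  by rewrite (embeds_U E) => /eqP; rewrite imset_eq0 => /eqP.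
apply: Iterate => // [|s1' st]; first exact: tss_progress.
have [s1 st1 E1] := tss_embeds_step f_inj f_adj E st.
exact: IH E1.
Qed.

(** * Monotonicity of activation and counting of neighbors *)

Lemma active_mono (G : sgraph) (t t' : G -> nat) (S S' : {set G}) l :
  (forall v, t' v <= t v) -> S \subset S' ->
  active t S l \subset active t' S' l.
Proof.
move=> le_t sSS'; elim: l => //= l IH; apply: setUSS => //.
apply/subsetP=> v; rewrite !inE => tv.
apply: leq_trans (le_t v) (leq_trans tv _).
by apply: subset_leq_card; apply: setIS.
Qed.

Lemma min_target_set_card (G : sgraph) (t : G -> nat) (S T : {set G}) :
  min_target_set t S -> min_target_set t T -> #|S| = #|T|.
Proof.
by case=> tS minS [tT minT]; apply/eqP; rewrite eqn_leq minS // minT.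
Qed.

Lemma target_set_leq (G : sgraph) (t t' : G -> nat) (S : {set G}) :
  (forall v, t' v <= t v) -> target_set t S -> target_set t' S.
Proof.
move=> le_t [l aT]; exists l; apply/eqP.
by rewrite -subTset -aT active_mono.
Qed.

Lemma card_nbhD1 (G : sgraph) (A : {set G}) (v x : G) :
  v \in A -> #|nbh x :&: (A :\ v)| = #|nbh x :&: A| - (x \in nbh v).
Proof.
move=> vA; have -> : nbh x :&: (A :\ v) = (nbh x :&: A) :\ v.
  by rewrite setIDA.
rewrite (cardsD1 v (nbh x :&: A)) !inE vA andbT adj_sym.
by rewrite addnC addnK.
Qed.

Lemma decE (V : finType) (A : {set V}) (f : {ffun V -> nat}) (x : V) :
  dec A f x = f x - (x \in A).
Proof. by rewrite ffunE; case: ifP => _; rewrite ?subn0. Qed.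

(** * Optimal TSS on residual instances *)

Section TssOptimal.
Variables (F : sgraph -> Prop) (F_hereditary : hereditary F).
Hypothesis tss_opt : optimal TSS F.
Variables (G : sgraph) (FG : F G).
Implicit Types (A U W : {set G}) (k d : {ffun G -> nat}).

(** The start of TSS on the graph induced by [A], kept on the nodes of [G] so that shrinking [A]
    does not change the type. *)
Definition tss_start A k : tss_state G :=
  TssState set0 A k [ffun v => #|nbh v :&: A|].

Lemma tss_start_returns A k :
  exists2 T : {set induced A}, min_target_set (fun x : induced A => k (val x)) T
    & tss_returns_card (tss_start A k) #|T|.
Proof.
pose t (x : induced A) := k (val x).
have r := tss_opt (F_hereditary A FG) t.
(* Using [r] twice yields the output of some execution. *)
have [s /= minT _] := always_returns_both r r.
exists (tss_S s) => //; rewrite -[#|_|]addn0.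
apply: (@tss_embeds_returns (induced A) G val 0 (tss_init t)).
- exact: val_inj.
- by [].
- split=> //=.
  + apply/setP=> x; apply/idP/imsetP => [xA|[y _ ->]]; last exact: valP.
    by exists (Sub x xA).
  + by move=> x _; rewrite ffunE.
  + move=> x _; rewrite !ffunE -(card_imset _ val_inj).
    apply: eq_card => y; apply/idP/imsetP => [/setIP[xy yA]|[z xz ->]].
      by exists (Sub y yA) => //; move: xy; rewrite !inE.
    by move: xz; rewrite !inE => xz; rewrite (valP z) andbT.
  + by rewrite !cards0.
  + by rewrite disjoints_subset sub0set.
  + by rewrite disjoints_subset sub0set.
by apply: always_returns_weaken r => s' minT'; apply: min_target_set_card minT.
Qed.

(** A target set survives lower thresholds, so the optimum cannot grow. *)
Lemma tss_start_leq A k k' n :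
  {in A, forall x, k' x <= k x} -> tss_returns_card (tss_start A k) n ->
  exists2 m, tss_returns_card (tss_start A k') m & m <= n.
Proof.
move=> le_k rn; have [T [tT _] rT] := tss_start_returns A k.
have [T' [_ minT'] rT'] := tss_start_returns A k'.
exists #|T'| => //; have [s /= <- ->] := always_returns_both rn rT.
by apply: minT'; apply: target_set_leq tT => x; apply: le_k; apply: valP.
Qed.

(** After the first step, the state differs from a fresh start on [A :\ v] only by the seeds [S1]
    and by irrelevant values outside [A :\ v]. It is thus an embedding along [id] with offset
    [#|S1|], and a common execution equates the two sizes. *)
Lemma tss_start_step A k n v (S1 : {set G}) k1 k' :
  v \in A -> [disjoint S1 & A :\ v] -> {in A :\ v, k' =1 k1} ->
  tss_returns_card (tss_start A k) n ->
  tss_step (tss_start A k)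
    (TssState S1 (A :\ v) k1 (dec (nbh v :&: A) [ffun x => #|nbh x :&: A|])) ->
  exists2 m, tss_returns_card (tss_start (A :\ v) k') m & n = m + #|S1|.
Proof.
move=> vA disS1 kE rn st.
have [T _ rT] := tss_start_returns (A :\ v) k'; exists #|T| => //.
case: rn => [A0 _|_ _ /(_ _ st) rn]; first by rewrite [A]A0 inE in vA.
pose s1 := TssState S1 (A :\ v) k1
  (dec (nbh v :&: A) [ffun x => #|nbh x :&: A|]).
suff E : tss_embeds id #|S1| (tss_start (A :\ v) k') s1.
  have rT1 := tss_embeds_returns (@inj_id G) (fun _ _ => erefl) E rT.
  by have [s /= -> ->] := always_returns_both rn rT1.
split=> //=.
- by rewrite imset_id.
- by move=> x /kE.
- move=> x /setD1P[xv xA]; rewrite decE !ffunE card_nbhD1 //.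
  by rewrite [x \in _ :&: _]inE xA andbT.
- by rewrite cards0.
- by rewrite disjoints_subset sub0set.
Qed.

(** * The invariant of MTS *)

(* [inv_order] says that the nodes of [L] can still be activated, the last ones
   moved to [L] first: whichever set [X] of them remains, some node of [X] is
   activated by its neighbors outside [X]. *)
Record mts_inv (t : G -> nat) (N : nat) (s : mts_state G) : Prop := MtsInv {
  inv_k : {in mts_U s, forall v, mts_k s v = t v - #|nbh v :&: ~: mts_U s|};
  inv_d : {in mts_U s :\: mts_L s, forall v,
             mts_d s v = #|nbh v :&: (mts_U s :\: mts_L s)|};
  inv_active : exists l, ~: mts_U s \subset active t (mts_S s) l;
  inv_order : forall X : {set G}, X \subset mts_U s :&: mts_L s -> X != set0 ->
    exists2 v, v \in X & mts_k s v <= #|nbh v :&: (mts_U s :\: X)|;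
  inv_opt : exists2 n,
    tss_returns_card (tss_start (mts_U s :\: mts_L s) (mts_k s)) n &
    #|mts_S s| + n <= N }.

Lemma mts_inv_progress t N (s : mts_state G) :
  mts_inv t N s -> mts_U s <> set0 -> exists s', mts_step (@adj G) s s'.
Proof.
case: s => S L U k d [/= _ _ _ order _] /eqP U0.
case: (case_selection k d U (U :\: L))
  => [[v vU kv]|[no1 [v vU dv]]|[no1 no2 maxP]].
- by eexists; apply: MtsCase1 kv.
- by eexists; apply: MtsCase2 dv.
have [/eqP|/set0Pn[v0 v0W]] := boolP (U :\: L == set0); last first.
  by have [v vW maxv] := maxP _ v0W; eexists; apply: MtsCase3 maxv.
(* No candidate is left outside [L], so [inv_order] applies to [X = U] and gives a node with
   threshold 0, which Case 1 would have taken. *)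
move/eqP; rewrite setD_eq0 => /setIidPl UL.
have [|v vU] := order U _ U0; first by rewrite UL.
by rewrite setDv setI0 cards0 leqn0 => /eqP kv; case: no1; exists v.
Qed.

(** * Preservation of the invariant *)

Lemma setDD1C (T : finType) (A B : {set T}) v : A :\ v :\: B = (A :\: B) :\ v.
Proof. by rewrite !setDDl setUC. Qed.

Lemma setCD1 (T : finType) (A : {set T}) v : ~: (A :\ v) = v |: ~: A.
Proof. by apply/setP=> x; rewrite !inE negb_and negbK. Qed.

Lemma residual_threshold t U k v :
  v \in U -> {in U, forall x, k x = t x - #|nbh x :&: ~: U|} ->
  {in U :\ v, forall x,
     dec (nbh v :&: U) k x = t x - #|nbh x :&: ~: (U :\ v)|}.
Proof.
move=> vU kE x /setD1P[xv xU].
rewrite decE kE // inE xU andbT -subnDA; congr (_ - _).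
have -> : ~: U = ~: (U :\ v) :\ v by rewrite setCD1 setU1K // inE vU.
rewrite card_nbhD1 ?subnK //; last by rewrite setCD1 setU11.
(* The subtraction is not truncated: if [x] is adjacent to [v], then [v] itself is counted. *)
case xNv: (x \in nbh v) => //; apply/card_gt0P; exists v.
by move: xNv; rewrite !inE eqxx adj_sym => ->.
Qed.

Lemma residual_degree W U d v :
  v \in W -> W \subset U -> {in W, forall x, d x = #|nbh x :&: W|} ->
  {in W :\ v, forall x, dec (nbh v :&: U) d x = #|nbh x :&: (W :\ v)|}.
Proof.
move=> vW WU dE x /setD1P[xv xW]; rewrite decE dE // card_nbhD1 //.
by rewrite inE (subsetP WU) // andbT.
Qed.

(** If [v] is adjacent to [x], its removal lowers both sides by one, up to truncation; otherwise
    neither changes. *)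
Lemma residual_order U L k v :
  v \in U ->
  (forall X : {set G}, X \subset U :&: L -> X != set0 ->
    exists2 x, x \in X & k x <= #|nbh x :&: (U :\: X)|) ->
  forall X : {set G}, X \subset (U :\ v) :&: L -> X != set0 ->
    exists2 x, x \in X &
      dec (nbh v :&: U) k x <= #|nbh x :&: ((U :\ v) :\: X)|.
Proof.
move=> vU order X; rewrite subsetI subsetD1 => /andP[/andP[XU vX] XL] X0.
have [|x xX kx] := order X _ X0; first by rewrite subsetI XU.
exists x => //; rewrite setDD1C card_nbhD1 ?inE ?vX //.
by rewrite decE !inE (subsetP XU) // andbT leq_sub2r.
Qed.

(** Cases 1 and 2 shrink [U]; Case 3 keeps [U] but shrinks [U :\: L]. Hence the measure is the sum
    of both sizes. *)
Lemma mts_inv_step t N (s s' : mts_state G) :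
  mts_inv t N s -> mts_step (@adj G) s s' ->
  mts_inv t N s' /\
  #|mts_U s'| + #|mts_U s' :\: mts_L s'| < #|mts_U s| + #|mts_U s :\: mts_L s|.
Proof.
move=> Is st; case: s s' / st Is
  => S L U k d v => [vU kv|no1 /setDP[vU vL] dv|no1 no2 vUL maxv];
  case=> /= kE dE [l act] order [n rn le_n].
- have ltU : #|U :\ v| < #|U| by rewrite [ltnRHS](cardsD1 v) vU.
  split; last first.
    rewrite -addSn leq_add //; apply: subset_leq_card.
    by apply: setSD; apply: subD1set.
  split=> /=.
  + exact: residual_threshold.
  + rewrite setDD1C; case: ifP => vL.
      have -> : (U :\: L) :\ v = U :\: L by rewrite setDDl (setUidPl _) ?sub1set.
      exact: dE.
    by apply: residual_degree => //; rewrite ?inE ?vL ?subsetDl.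
  (* As [k v = 0], at least [t v] neighbors of [v] lie outside [U]; all are active at time [l]. *)
  + exists l.+1; rewrite setCD1 subUset sub1set /= !inE subsetU ?act // andbT.
    apply/orP; right; apply: leq_trans (subset_leq_card (setIS _ act)).
    by rewrite -subn_eq0 -kE // kv.
  + exact: residual_order.
  (* A node of [L] leaves [U :\: L] intact and only lowers thresholds; any other node is a Case 1
     choice of TSS. *)
  + rewrite setDD1C; have [vL|vL] := boolP (v \in L).
      have -> : (U :\: L) :\ v = U :\: L by rewrite setDDl (setUidPl _) ?sub1set.
      have [|m rm le_m] := @tss_start_leq _ k (dec (nbh v :&: U) k) n _ rn.
        by move=> x _; rewrite decE leq_subr.
      by exists m => //; apply: leq_trans le_n; rewrite leq_add2l.
    have vW : v \in U :\: L by rewrite inE vL.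
    have [|||m rm nE] := @tss_start_step _ k n v set0
      (dec (nbh v :&: (U :\: L)) k) (dec (nbh v :&: U) k) vW _ _ rn.
    * by rewrite disjoints_subset sub0set.
    * by move=> x; rewrite !decE !inE => /and3P[_ -> ->].
    * exact: TssCase1.
    by exists m => //; move: nE; rewrite cards0 addn0 => <-.
- have vW : v \in U :\: L by rewrite inE vL.
  have ltU : #|U :\ v| < #|U| by rewrite [ltnRHS](cardsD1 v) vU.
  split; last first.
    rewrite -addSn leq_add //; apply: subset_leq_card.
    by apply: setSD; apply: subD1set.
  split=> /=.
  + exact: residual_threshold.
  + by rewrite setDD1C; apply: residual_degree => //; rewrite subsetDl.
  + exists l; rewrite setCD1 subUset sub1set.
    apply/andP; split; last first.
      by apply: subset_trans act _; apply: active_mono => //; apply: subsetUr.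
    have sub0 : v |: S \subset active t (v |: S) l.
      by elim: (l) => //= j IH; apply: subset_trans IH (subsetUl _ _).
    by apply: (subsetP sub0); rewrite setU11.
  + exact: residual_order.
  + rewrite setDD1C.
    have [|||m rm nE] := @tss_start_step _ k n v (v |: set0)
      (dec (nbh v :&: (U :\: L)) k) (dec (nbh v :&: U) k) vW _ _ rn.
    * by apply: disjointU1D1; rewrite disjoints_subset sub0set.
    * by move=> x; rewrite !decE !inE => /and3P[_ -> ->].
    * apply: TssCase2 => //; last by rewrite ffunE -dE.
      by case=> x /setDP[xU _] kx; case: no1; exists x.
    (* The new seed adds at most one to [#|S|], while the residual optimum drops by exactly one. *)
    exists m => //; apply: leq_trans le_n; rewrite nE setU0 cards1 addn1 addnS.
    by rewrite -addSn leq_add2r cardsU1 -add1n leq_add2r leq_b1.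
- have [vU vL] := setDP vUL.
  have WE : U :\: (v |: L) = (U :\: L) :\ v by rewrite setUC -setDDl.
  split; last by rewrite WE ltn_add2l [ltnRHS](cardsD1 v) vUL.
  split=> //=.
  + by rewrite WE; apply: residual_degree => //; rewrite subsetDl.
  + by exists l.
  (* If [v] is in [X], the failure of Case 2 gives [k v <= d v], and the neighbors counted by [d v]
     lie outside [L] and differ from [v], hence lie outside [X]. Otherwise the old order applies. *)
  + move=> X XUL X0; have [vX|vX] := boolP (v \in X).
      exists v => //; apply: (@leq_trans (d v)).
        by rewrite leqNgt; apply/negP => dv; case: no2; exists v.
      rewrite dE //; apply: subset_leq_card; apply/subsetP=> x.
      rewrite !inE => /and3P[vx xL xU]; rewrite vx xU andbT /=.
      apply/negP => /(subsetP XUL); rewrite !inE xU (negPf xL) orbF /= => /eqP xv.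
      by rewrite xv adj_irrefl in vx.
    apply: order => //; apply/subsetP=> x xX.
    have := subsetP XUL x xX; rewrite !inE.
    by have [xv|_ //] := eqVneq x v; rewrite -xv xX in vX.
  + rewrite WE; have [|||m rm nE] :=
      @tss_start_step _ k n v set0 k k vUL _ _ rn.
    * by rewrite disjoints_subset sub0set.
    * by [].
    * apply: TssCase3 => // [[x /setDP[xU _] kx]|[x xW dx]|x xW].
      - by case: no1; exists x.
      - by case: no2; exists x => //; rewrite dE //; rewrite ffunE in dx.
      - by have := maxv x xW; rewrite /score !ffunE !dE.
    by exists m => //; move: nE; rewrite cards0 addn0 => <-.
Qed.

Lemma mts_inv_init t :
  exists2 T, min_target_set t T & mts_inv t #|T| (mts_init (@adj G) t).
Proof.
have r := tss_opt FG t; have [s /= minT _] := always_returns_both r r.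
have nbhT v : nbh v :&: [set: G] = nbh v by rewrite setIT.
exists (tss_S s) => //; split=> /=.
- by move=> v _; rewrite ffunE setCT setI0 cards0 subn0.
- move=> v _; rewrite ffunE setD0 nbhT.
  by apply: eq_card => x; rewrite !inE adj_sym.
- by exists 0; rewrite setCT sub0set.
- by move=> X; rewrite setI0 subset0 => /eqP->; rewrite eqxx.
exists #|tss_S s|; last by rewrite cards0.
rewrite setD0; have -> : tss_start [set: G] [ffun v => t v] = tss_init t.
  by congr TssState; apply/ffunP=> v; rewrite !ffunE nbhT.
by apply: always_returns_weaken r => s' minT'; apply: min_target_set_card minT.
Qed.

End TssOptimal.

Theorem theorem3 (F : sgraph -> Prop) (F_hereditary : hereditary F) :
  optimal TSS F -> optimal MTS F.
Proof.
move=> tss_opt G FG t.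
have [T [_ minT] inv0] := mts_inv_init tss_opt FG t.
apply: (always_returns_invariant
  (m := fun s => #|mts_U s| + #|mts_U s :\: mts_L s|) _ _ _ _ inv0).
- by move=> s; case: (eqVneq (mts_U s) set0) => [|/eqP]; [left | right].
- exact: mts_inv_progress.
- exact: (mts_inv_step F_hereditary tss_opt FG).
(* With [U] empty, [inv_active] makes every node active, and [inv_opt] bounds [#|S|] by the optimum
   [#|T|]. *)
- move=> s [_ _ [l act] _ [n _ le_n]] U0; split.
    by exists l; apply/eqP; rewrite -subTset -setC0 -U0.
  by move=> T' /minT; apply: leq_trans; apply: leq_trans (leq_addr _ _) le_n.
Qed.
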